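(* Let $\mathbb{K}$ be a field and let $I\subseteq\mathbb{K}[x_1,\ldots,x_n]$ be a square-free monomial ideal with $\mathrm{index}(I)>1$, where $n\leq 5$. Then $\mathrm{index}(I^k)>1$ for all $k\geq 1$.
   Context: $S=\mathbb{K}[x_1,\ldots,x_n]$ has the standard grading. The index is considered for nonzero ideals generated in a single degree. Graded Betti numbers: $\beta_{i,j}(I)=\dim_{\mathbb{K}}\mathrm{Tor}^S_i(\mathbb{K},I)_j$ (Betti numbers of the module $I$). A nonzero monomial ideal $I$ is $r$-step linear if it is generated in a single degree $d$ and $\beta_{i,j}(I)=0$ for all $(i,j)$ with $0\le i\le r$ and $j-i>d$; the Green-Lazarsfeld index is $\mathrm{index}(I)=\sup\{r: I\text{ is }r\text{-step linear}\}+1$ (possibly $\infty$). In particular, $\mathrm{index}(I)>1$ includes the requirement that $I$ is generated in a single degree. *)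

(* Defs.v *)
From HB Require Import structures.
From mathcomp Require Import all_boot all_order all_algebra.
(* multinomials has to be imported before the classical library: in the other
   order their notations clash *)
From mathcomp Require Export mpoly.
From mathcomp Require Import ring.
From mathcomp Require Export boolp classical_sets constructive_ereal.

Set Implicit Arguments.
Unset Strict Implicit.
Unset Printing Implicit Defensive.

Import Order.TTheory GRing.Theory Num.Theory.

Local Open Scope classical_set_scope.
Local Open Scope ring_scope.

(* Subsets of {mpoly K[n]} are classical sets; ideals are presented by
   generating sets, so that the unit ideal and the zero ideal are both allowed. *)

Definition ideal_gen (K : fieldType) (n : nat) (G : set {mpoly K[n]}) :
    set {mpoly K[n]} :=
  [set p | exists (s : nat) (a g : 'I_s -> {mpoly K[n]}),
     (forall i, G (g i)) /\ p = \sum_(i < s) a i * g i].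

Fixpoint ideal_pow (K : fieldType) (n : nat) (I : set {mpoly K[n]}) (k : nat) :
    set {mpoly K[n]} :=
  if k is k'.+1 then
    ideal_gen [set p | exists f g, [/\ I f, ideal_pow I k' g & p = f * g]]
  else setT.

Definition monomial_ideal (K : fieldType) (n : nat) (I : set {mpoly K[n]}) :
    Prop :=
  exists M : set 'X_{1..n}, I = ideal_gen [set 'X_[K, m] | m in M].

Definition squarefree_monomial_ideal (K : fieldType) (n : nat)
    (I : set {mpoly K[n]}) : Prop :=
  exists M : set 'X_{1..n},
    (forall m, M m -> forall i : 'I_n, (m i <= 1)%N) /\
    I = ideal_gen [set 'X_[K, m] | m in M].

Definition generated_in_degree (K : fieldType) (n : nat) (I : set {mpoly K[n]})
    (d : nat) : Prop :=
  I = ideal_gen [set p | I p /\ p \is d.-homog].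

(* The Koszul complex of x_1, ..., x_n over S = K[x_1, ..., x_n].  A family
   c : {ffun {set 'I_n} -> S} stands for the sum of the c A * e_A, where
   e_A = e_{i_1} /\ ... /\ e_{i_p} for A = {i_1 < ... < i_p}; it lies in
   homological degree p when c is supported on the sets of cardinal p.  From
     d e_A = \sum_(i in A) (-1)^#{b in A | b < i} x_i e_(A \ i)
   one gets the B-coordinate of d c given below. *)
Definition koszul_diff (K : fieldType) (n : nat)
    (c : {ffun {set 'I_n} -> {mpoly K[n]}}) : {ffun {set 'I_n} -> {mpoly K[n]}} :=
  [ffun B : {set 'I_n} => \sum_(i < n | i \notin B)
     (-1) ^+ #|[pred b in B | (b < i)%N]| * 'X_i * c (i |: B)%SET].

Definition koszul_deg (K : fieldType) (n : nat) (p : nat)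
    (c : {ffun {set 'I_n} -> {mpoly K[n]}}) : Prop :=
  forall A : {set 'I_n}, #|A| <> p -> c A = 0.

(* koszul_diffK, koszul_exact and koszul_augmentation show that this is a
   free resolution of K = S / (x_1, ..., x_n) *)
Section KoszulResolution.
Variables (K : fieldType) (n : nat).
Implicit Types (c : {ffun {set 'I_n} -> {mpoly K[n]}}) (A B : {set 'I_n}).

Lemma koszul_diff_deg p c :
  koszul_deg p.+1 c -> koszul_deg p (koszul_diff c).
Proof.
move=> hc B hB; rewrite ffunE big1 // => i iB.
by rewrite hc ?mulr0 // cardsU1 iB add1n => -[].
Qed.

Lemma koszul_sign_lt (i j : 'I_n) B : (i < j)%N -> i \notin B ->
  #|[pred b in (i |: B)%SET | (b < j)%N]| = #|[pred b in B | (b < j)%N]|.+1.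
Proof.
move=> ij iB.
rewrite -[RHS]add1n (cardD1 i) !inE eqxx ij /=; congr (_ + _)%N.
apply: eq_card => b; rewrite !inE; case: eqVneq => //= ->.
by rewrite (negbTE iB).
Qed.

Lemma koszul_sign_ge (i j : 'I_n) B : (j <= i)%N ->
  #|[pred b in (i |: B)%SET | (b < j)%N]| = #|[pred b in B | (b < j)%N]|.
Proof.
move=> ij; apply: eq_card => b; rewrite !inE.
by case: eqVneq => [->|//]; rewrite ltnNge ij /= !andbF.
Qed.

Lemma koszul_diffK c : koszul_diff (koszul_diff c) = 0.
Proof.
apply/ffunP => B; rewrite !ffunE.
pose F (i j : 'I_n) : {mpoly K[n]} :=
  (-1) ^+ #|[pred b in B | (b < i)%N]| * 'X_i *
  ((-1) ^+ #|[pred b in (i |: B)%SET | (b < j)%N]| * 'X_j * c (j |: (i |: B))%SET).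
have FN (i j : 'I_n) : i \notin B -> j \notin B -> (i < j)%N ->
    F i j = - F j i.
  move=> iB jB ij; rewrite /F (koszul_sign_lt ij iB) (koszul_sign_ge _ (ltnW ij)).
  have -> : (j |: (i |: B))%SET = (i |: (j |: B))%SET by rewrite finset.setUCA.
  rewrite exprS; move: ((-1) ^+ _) ((-1) ^+ _) (c _) => a b e.
  by ring.
transitivity (\sum_(i < n | i \notin B) \sum_(j < n | j \notin (i |: B)%SET) F i j).
  by apply: eq_bigr => i iB; rewrite ffunE mulr_sumr.
transitivity (\sum_(i < n | i \notin B)
   (\sum_(j < n | (j \notin B) && (i < j)%N) F i j +
    \sum_(j < n | (j \notin B) && (j < i)%N) F i j)).
  apply: eq_bigr => i iB; rewrite (bigID (fun j : 'I_n => (i < j)%N)) /=.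
  congr (_ + _); apply: eq_bigl => j; rewrite !inE negb_or -val_eqE /=;
    by case: ltngtP; rewrite ?andbF ?andbT.
rewrite big_split /=.
rewrite [X in _ + X](exchange_big_dep (fun j : 'I_n => j \notin B)) /=; last first.
  by move=> i j _ /andP[].
rewrite -big_split /= big1 // => i iB.
rewrite [X in _ + X](eq_bigl (fun j : 'I_n => (j \notin B) && (i < j)%N)).
  rewrite -big_split /= big1 // => j /andP[jB ij].
  by rewrite FN // addNr.
by move=> j; rewrite iB.
Qed.

Let least (i : 'I_n) A := (i \in A) && [forall j in A, (i <= j)%N].
Let below (i : 'I_n) (m : 'X_{1..n}) := [forall j : 'I_n, (j < i)%N ==> (m j == 0%N)].

(* contracting homotopy: x^m e_A is sent to x^m / x_i * (e_i /\ e_A), where i is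
   the least index occurring in x^m e_A *)
Let hcoef c A (m : 'X_{1..n}) : K :=
  if [pick i | least i A] is Some i then
    if below i m then (c (A :\ i)%SET)@_(m + U_(i))%MM else 0
  else 0.

Let homotopy c : {ffun {set 'I_n} -> {mpoly K[n]}} :=
  [ffun A => \sum_(m : 'X_{1..n < \max_B msize (c B)}) hcoef c A m *: 'X_[m]].

Let homotopyE c A m : (homotopy c A)@_m = hcoef c A m.
Proof.
rewrite ffunE; case: (ltnP (mdeg m) (\max_B msize (c B))) => hm.
  by rewrite (mcoeff_mpoly (hcoef c A)).
rewrite raddf_sum /= big1 => [|[m' hm'] _] /=; last first.
  rewrite mcoeffZ mcoeffX; case: eqP => [E|_]; last by rewrite mulr0.
  by move: hm'; rewrite E ltnNge hm.
rewrite /hcoef; case: pickP => // i _; case: ifP => // _.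
rewrite memN_msupp_eq0 //; apply/msize_mdeg_ge.
rewrite mdegD mdeg1 addn1; apply: leq_trans (leqW hm).
exact: (leq_bigmax (F := fun B => msize (c B))).
Qed.

Let least_uniq i j A : least i A -> least j A -> i = j.
Proof.
move=> /andP[iA /forall_inP hi] /andP[jA /forall_inP hj].
by apply/val_inj/anti_leq; rewrite hi // hj.
Qed.

Let hcoefE i c A m : least i A ->
  hcoef c A m = if below i m then (c (A :\ i)%SET)@_(m + U_(i))%MM else 0.
Proof.
move=> hi; rewrite /hcoef; case: pickP => [j /least_uniq-/(_ _ hi) -> //|/(_ i)].
by rewrite hi.
Qed.

Let diffE c B m : (koszul_diff c B)@_m =
  \sum_(i < n | (i \notin B) && (m i != 0%N))
    (-1) ^+ #|[pred b in B | (b < i)%N]| * (c (i |: B)%SET)@_(m - U_(i))%MM.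
Proof.
rewrite ffunE raddf_sum /= big_mkcondr /=; apply: eq_bigr => i iB.
have -> : (-1) ^+ #|[pred b in B | (b < i)%N]| =
   ((-1) ^+ #|[pred b in B | (b < i)%N]|)%:MP_[n] :> {mpoly K[n]}.
  by rewrite rmorphXn /= rmorphN rmorph1.
rewrite -mulrA mcoeffCM; case: eqP => /= [m0|/eqP m0]; last first.
  rewrite -[in LHS](@submK _ U_(i)%MM m); last by rewrite lep1mP.
  by rewrite addmC ['X_i * _]mulrC mcoeffMX.
rewrite mcoeffM big1 ?mulr0 // => -[k1 k2] /= /eqP E.
rewrite mcoeffX; case: eqP => [k1E|]; last by rewrite mul0r.
by move/mnmP: E => /(_ i); rewrite m0 -k1E mnmDE mnm1E eqxx.
Qed.

Let homotopy_id c B m : (B != finset.set0) || (m != 0%MM) ->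
  (koszul_diff (homotopy c) B)@_m + (homotopy (koszul_diff c) B)@_m = (c B)@_m.
Proof.
move=> Bm; have [i0 Pi0] : exists i0 : 'I_n, (i0 \in B) || (m i0 != 0%N).
  case/orP: Bm => [/set0Pn[i iB]|m0]; first by exists i; rewrite iB.
  apply: contrapT => H; case/eqP: m0; apply/mnmP => i; rewrite mnm0E.
  by apply/eqP; apply: contrapT => /negP mi; apply: H; exists i; rewrite mi orbT.
case: (@arg_minnP _ i0 (fun i => (i \in B) || (m i != 0%N)) val Pi0) => i Pi imin.
have {imin} ltB (j : 'I_n) : (j < i)%N -> (j \notin B) && (m j == 0%N).
  move=> ji; rewrite -[_ == _]negbK -negb_or; apply/negP => /imin /=.
  by rewrite leqNgt ji.
have leB (j : 'I_n) : j \in B -> (i <= j)%N.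
  by move=> jB; rewrite leqNgt; apply/negP => /ltB; rewrite jB.
have lem (j : 'I_n) : m j != 0%N -> (i <= j)%N.
  by move=> mj; rewrite leqNgt; apply/negP => /ltB /andP[_]; rewrite (negbTE mj).
rewrite homotopyE diffE.
have [iB|iB] := boolP (i \in B).
  have lB : least i B by rewrite /least iB; apply/forall_inP.
  rewrite (hcoefE _ _ lB) ifT; last first.
    by apply/forallP => j; apply/implyP => /ltB /andP[].
  rewrite diffE [X in _ + X](bigD1 i) /=; last by rewrite !inE eqxx mnmDE mnm1E eqxx addn1.
  rewrite finset.setD1K // addmK.
  have -> : #|[pred b in (B :\ i)%SET | (b < i)%N]| = 0%N.
    apply: eq_card0 => b; rewrite !inE; apply/negP => /andP[/andP[_ /leB ib]].
    by rewrite ltnNge ib.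
  rewrite expr0 mul1r addrCA -[RHS]addr0; congr (_ + _).
  rewrite [X in _ + X](eq_bigl (fun j => (j \notin B) && (m j != 0%N))); last first.
    move=> j; rewrite !inE mnmDE mnm1E negb_and negbK (eq_sym i j).
    by have [->|ji] := eqVneq j i; rewrite ?iB ?andbF ?addn0 ?andbT.
  rewrite -big_split /= big1 // => j /andP[jB mj].
  have ij : (i < j)%N.
    rewrite ltn_neqAle lem // andbT; apply: contra jB => /eqP /val_inj <-.
    exact: iB.
  have iNj : i != j by apply: contraTneq ij => ->; rewrite ltnn.
  have lj : least i (j |: B)%SET.
    rewrite /least !inE iB orbT; apply/forall_inP => b; rewrite !inE.
    by case/orP => [/eqP ->|/leB //]; exact: ltnW.
  rewrite homotopyE (hcoefE _ _ lj) ifT; last first.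
    apply/forallP => b; apply/implyP => bi; rewrite mnmBE.
    by case/andP: (ltB _ bi) => _ /eqP ->.
  have -> : ((j |: B) :\ i = j |: (B :\ i))%SET.
    apply/setP => b; rewrite !inE.
    by have [->|//] := eqVneq b i; rewrite (negbTE iNj).
  have -> : (m - U_(j) + U_(i) = m + U_(i) - U_(j))%MM.
    apply/mnmP => b; rewrite !(mnmDE, mnmBE, mnm1E) addnBAC //.
    by case: eqP => [<-|//]; rewrite lt0n.
  have -> : #|[pred b in B | (b < j)%N]| = #|[pred b in (B :\ i)%SET | (b < j)%N]|.+1.
    by rewrite -[in LHS](finset.setD1K iB) koszul_sign_lt ?inE ?eqxx.
  by rewrite exprS mulN1r mulNr addNr.
have mi : m i != 0%N by move: Pi; rewrite (negbTE iB).
have -> : hcoef (koszul_diff c) B m = 0.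
  rewrite /hcoef; case: pickP => // j /andP[jB _]; rewrite ifF //.
  apply/negP => /forallP /(_ i); rewrite (negbTE mi) implybF => /negP[].
  rewrite ltn_neqAle leB // andbT.
  by apply: contra iB => /eqP /val_inj ->.
have il : least i (i |: B)%SET.
  rewrite /least !inE eqxx; apply/forall_inP => b; rewrite !inE.
  by case/orP => [/eqP ->|/leB].
rewrite addr0 (bigD1 i) /=; last by rewrite iB mi.
rewrite homotopyE (hcoefE _ _ il) ifT; last first.
  apply/forallP => b; apply/implyP => bi; rewrite mnmBE.
  by case/andP: (ltB _ bi) => _ /eqP ->.
rewrite finset.setU1K // submK ?lep1mP //.
rewrite [X in _ ^+ X]eq_card0 ?expr0 ?mul1r; last first.
  move=> b; rewrite !inE; apply/negP => /andP[/leB ib].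
  by rewrite ltnNge ib.
rewrite big1 ?addr0 // => j /andP[/andP[jB mj] ji].
rewrite homotopyE /hcoef; case: pickP => [b /andP[bjB _]|]; last by rewrite mulr0.
rewrite ifF ?mulr0 //; apply/negP => /forallP /(_ i).
have ib : (i < b)%N.
  move: bjB; rewrite !inE ltn_neqAle => /orP[/eqP ->|bB].
    by rewrite lem // andbT; apply: contra ji => /eqP /val_inj ->.
  by rewrite leB // andbT; apply: contra iB => /eqP /val_inj ->.
by rewrite ib mnmBE mnm1E (negbTE ji) subn0 (negbTE mi).
Qed.

Let homotopy_deg p c : koszul_deg p c -> koszul_deg p.+1 (homotopy c).
Proof.
move=> hc A hA; apply/mpolyP => m; rewrite homotopyE mcoeff0 /hcoef.
case: pickP => // i /andP[iA _]; rewrite hc ?mcoeff0 ?if_same // => Ai.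
by apply: hA; rewrite (cardsD1 i) iA Ai.
Qed.

Let diff_at0 c : (koszul_diff c finset.set0)@_0%MM = 0.
Proof. by rewrite diffE big1 // => i; rewrite mnm0E eqxx andbF. Qed.

Let koszul_bound c : koszul_diff c = 0 -> (c finset.set0)@_0%MM = 0 ->
  koszul_diff (homotopy c) = c.
Proof.
move=> dc c0; apply/ffunP => B; apply/mpolyP => m.
have [Bm|] := boolP ((B != finset.set0) || (m != 0%MM)).
  rewrite -(homotopy_id c Bm) dc homotopyE /hcoef.
  case: pickP => [i _|_]; last by rewrite addr0.
  by rewrite [(0 : {ffun {set _} -> {mpoly K[n]}}) _]ffunE mcoeff0 if_same addr0.
by rewrite negb_or !negbK => /andP[/eqP -> /eqP ->]; rewrite diff_at0 c0.
Qed.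

Lemma koszul_exact p c : koszul_deg p.+1 c -> koszul_diff c = 0 ->
  exists2 b, koszul_deg p.+2 b & koszul_diff b = c.
Proof.
move=> hc dc; exists (homotopy c); first exact: homotopy_deg.
by apply: koszul_bound; rewrite // hc ?mcoeff0 // cards0.
Qed.

Lemma koszul_augmentation c : koszul_deg 0 c ->
  (c finset.set0)@_0%MM = 0 <->
  exists2 b, koszul_deg 1 b & koszul_diff b = c.
Proof.
move=> hc; split=> [c0|[b _ <-]]; last exact: diff_at0.
exists (homotopy c); first exact: homotopy_deg.
apply: koszul_bound => //; apply/ffunP => B; rewrite !ffunE big1 // => i iB.
by rewrite hc ?mulr0 // cardsU1 iB.
Qed.

End KoszulResolution.

(* The strand of internal degree j of K_i (x) I: K_i is free on the e_A with
   #|A| = i, and such an e_A has degree i *)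
Definition koszul_chains (K : fieldType) (n : nat) (I : set {mpoly K[n]})
    (i j : nat) : set {ffun {set 'I_n} -> {mpoly K[n]}} :=
  [set c | koszul_deg i c /\ forall A : {set 'I_n},
     I (c A) /\ forall m, m \in msupp (c A) -> (mdeg m + #|A|)%N = j].

(* dim_K (Z / B), as the supremum of the cardinals of the families in Z that are
   linearly independent modulo B *)
Definition quot_dim (K : fieldType) (V : lmodType K) (Z B : set V) : \bar int :=
  supremum 0%E [set b%:Z%:E | b in [set b : nat |
    exists v : 'I_b -> V, (forall l, Z (v l)) /\
      forall a : 'I_b -> K, B (\sum_(l < b) a l *: v l) -> forall l, a l = 0]].

(* dim_K Tor_i^S(K, I)_j, computed from the Koszul resolution of K as the
   homology of K_* (x) I; Betti numbers of the module I, not of S / I *)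
Definition betti (K : fieldType) (n : nat) (I : set {mpoly K[n]}) (i j : nat) :
    \bar int :=
  quot_dim [set c | koszul_chains I i j c /\ koszul_diff c = 0]
           [set koszul_diff c | c in koszul_chains I i.+1 j].

Definition step_linear (K : fieldType) (n : nat) (I : set {mpoly K[n]})
    (r : nat) : Prop :=
  [/\ monomial_ideal I, exists2 p, I p & p != 0 &
      exists d : nat, generated_in_degree I d /\
        forall i j : nat, (i <= r)%N -> (d + i < j)%N -> betti I i j = 0%E].

(* sup {r | I is r-step linear} + 1 in the extended integers; it is -oo when I is
   not r-step linear for any r, in particular when I is zero or not generated in
   a single degree *)
Definition gl_index (K : fieldType) (n : nat) (I : set {mpoly K[n]}) : \bar int :=
  (supremum -oo [set r%:Z%:E | r in [set r : nat | step_linear I r]] + 1)%E.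

(* Main.v *)
Require Import Defs.
From HB Require Import structures.
From mathcomp Require Import all_boot all_order all_algebra.
From mathcomp Require Import mpoly zify.
From mathcomp Require Import boolp classical_sets constructive_ereal.

Set Implicit Arguments.
Unset Strict Implicit.
Unset Printing Implicit Defensive.

Import Order.TTheory GRing.Theory Num.Theory.

Local Open Scope ring_scope.

(** Linear relations of a monomial ideal are a connectivity property.  In
    multidegree a, the first Koszul homology of I is the reduced homology in
    degree 0 of the graph on the variables p with x^a / x_p in I, where p and q
    are joined when x^a / (x_p x_q) lies in I.  Consequently, if I is generated
    in degree D and any two generators u, v dividing a monomial L are joined by
    a path of generators dividing L, consecutive ones differing by an exchange
    of variables, then I has linear relations ([betti1_eq0]).  Conversely, if I
    is squarefree with linear relations, and A, B are two generators such that
    B has exactly two variables outside of A, then some generator inside the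
    union of A and B has exactly one variable outside of A
    ([betti1_locally_linked]).

    It remains to find the paths in the powers from this local condition
    ([ksums_linked]).  Let u and v be products of k generators.  The exchanges
    allowed in u raise a variable c with u_c < v_c, and symmetrically for v.
    If u and v have a common factor, one concludes by induction on k.  If a
    factor A of u and a factor B of v differ by an exchange raising such a c,
    or the same with u and v interchanged, the exchange itself creates a common
    factor.  Otherwise, if u_c < v_c, every factor of v containing c has two
    variables outside of every factor of u avoiding c; with at most five
    variables the generators are then pairs, or complements of pairs among five
    variables.  One finds factors A of u and B of v whose differences A \ B and
    B \ A consist of excess variables of u and of v, and which have at most one
    variable in common ([excess_pair]).  The local condition gives first steps
    from A towards B and from B towards A, and one of them, or the two
    together, bring u and v closer. *)

(** * Paths of exchanges between monomials *)

Section Linked.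
Variable n : nat.
Implicit Types (G : 'X_{1..n} -> Prop) (u v w L : 'X_{1..n}).

(** A path inside G from one monomial to another along which every step trades
    one variable for another and every monomial divides L.  Bounding by an
    arbitrary common multiple L, rather than by the lcm of the endpoints, makes
    the notion transitive and compatible with translation. *)
Inductive linked G L : 'X_{1..n} -> 'X_{1..n} -> Prop :=
| linked_refl u : G u -> (u <= L)%MM -> linked G L u u
| linked_step u v w b c : G u -> (u <= L)%MM ->
    (u + U_(c) = v + U_(b))%MM -> linked G L v w -> linked G L u w.

Lemma linked_src G L u v : linked G L u v -> G u /\ (u <= L)%MM.
Proof. by case. Qed.

Lemma linked_trans G L u v w : linked G L u v -> linked G L v w -> linked G L u w.
Proof.
elim=> // {}u {}v x b c Gu uL E _ IH vw.
exact: linked_step Gu uL E (IH vw).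
Qed.

Lemma linked_sym G L u v : linked G L u v -> linked G L v u.
Proof.
elim=> [{}u Gu uL|{}u {}v w b c Gu uL E vw wv]; first exact: linked_refl.
have [Gv vL] := linked_src vw.
apply: linked_trans wv _; apply: linked_step Gv vL (esym E) _.
exact: linked_refl.
Qed.

Lemma linked_translate G G' L w u v : (forall x, G x -> G' (w + x)%MM) ->
  linked G L u v -> linked G' (w + L)%MM (w + u)%MM (w + v)%MM.
Proof.
move=> GG'.
have le x : (x <= L)%MM -> (w + x <= w + L)%MM.
  by move=> /mnm_lepP xL; apply/mnm_lepP => i; rewrite !mnmDE leq_add2l.
elim=> [x Gx xL|x y z b c Gx xL E _ IH].
  by apply: linked_refl; [exact: GG'|exact: le].
apply: (@linked_step _ _ _ (w + y)%MM _ b c) IH; [exact: GG'|exact: le|].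
by rewrite -!addmA E.
Qed.

End Linked.

(** * Sums of subsets and the exchange argument *)

Section SquarefreeSums.
Variable n : nat.
Implicit Types (A B : {set 'I_n}) (s t : seq {set 'I_n}) (F : {set 'I_n} -> Prop).
Implicit Types (u v w L : 'X_{1..n}).

(** A squarefree monomial is a subset of the variables, and a product of
    squarefree monomials is the multiplicity function of a list of subsets. *)
Definition set_sum s : 'X_{1..n} := (\sum_(A <- s) mesym1 A)%MM.

Definition ksums F k : 'X_{1..n} -> Prop :=
  fun m => exists s, [/\ size s = k, {in s, forall A, F A} & m = set_sum s].

Lemma set_sumE s c : set_sum s c = count (fun A => c \in A) s.
Proof.
rewrite /set_sum mnm_sumE; elim: s => [|A s IH]; first by rewrite big_nil.
by rewrite big_cons IH mnmE.
Qed.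

Lemma set_sum_cons A s : set_sum (A :: s) = (mesym1 A + set_sum s)%MM.
Proof. by rewrite /set_sum big_cons. Qed.

Lemma set_sum_rem A s : A \in s -> set_sum s = (mesym1 A + set_sum (rem A s))%MM.
Proof.
move=> As; rewrite -set_sum_cons; apply/mnmP => i; rewrite !set_sumE.
by move/perm_to_rem/permP: As => ->.
Qed.

Lemma mdeg_set_sum d s : {in s, forall A, #|A| = d} -> mdeg (set_sum s) = (d * size s)%N.
Proof.
move=> sd; rewrite /set_sum mdeg_sum big_seq (eq_bigr (fun=> d)); last first.
  by move=> A /sd Ad; rewrite mdeg_mesym1.
by rewrite -big_seq big_const_seq count_predT iter_addn_0.
Qed.

Lemma ksums_deg F d k m : (forall A, F A -> #|A| = d) -> ksums F k m -> mdeg m = (d * k)%N.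
Proof.
by move=> Fd [s [sk sF ->]]; rewrite (mdeg_set_sum (d := d)) ?sk // => A /sF /Fd.
Qed.

Lemma exchange_sum A B b c s : A \in s -> A :\: B = [set b] -> B :\: A = [set c] ->
  (set_sum s + U_(c) = set_sum (B :: rem A s) + U_(b))%MM.
Proof.
move=> As AB BA; rewrite (set_sum_rem As) set_sum_cons.
apply/mnmP => i; rewrite !mnmDE !mnm1E !mnmE.
move/setP/(_ i): AB; move/setP/(_ i): BA; rewrite !inE ![i == _]eq_sym.
by case: (i \in A); case: (i \in B) => /= <- <-; lia.
Qed.

(** Raising a variable in which u falls short of v stays below every common
    multiple of u and v: such exchanges are the only ones made below. *)
Lemma exchange_le u u' v L b c : (u + U_(c) = u' + U_(b))%MM ->
  (u <= L)%MM -> (v <= L)%MM -> (u c < v c)%N -> (u' <= L)%MM.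
Proof.
move=> /mnmP E /mnm_lepP uL /mnm_lepP vL uv; apply/mnm_lepP => i.
move: (E i) (uL i) (vL i); rewrite !mnmDE !mnm1E.
by have [<-|_] := eqVneq c i; lia.
Qed.

Lemma deg_eq_excess u v : mdeg u = mdeg v -> u <> v -> exists c, (u c < v c)%N.
Proof.
move=> duv nuv; apply: contrapT => H; apply: nuv.
have vu : (v <= u)%MM.
  by apply/mnm_lepP => i; rewrite leqNgt; apply/negP => hi; apply: H; exists i.
rewrite -(submK vu); suff /eqP -> : (u - v)%MM == 0%MM by rewrite add0m.
by rewrite -mdeg_eq0; move: duv; rewrite -{1}(submK vu) mdegD; lia.
Qed.

(** The value of a sum at c counts the members containing c, at most all of
    them, so a strict inequality at c forces both a member avoiding c on the
    small side and a member containing c on the large side. *)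
Lemma excess_blocks s t c : size s = size t -> (set_sum s c < set_sum t c)%N ->
  (exists2 A, A \in s & c \notin A) /\ (exists2 B, B \in t & c \in B).
Proof.
rewrite !set_sumE => st lt; split.
  apply/hasP/negbNE/negP => /hasPn H; move: lt.
  suff -> : count (fun A => c \in A) s = size s by rewrite st ltnNge count_size.
  by apply/eqP; rewrite -all_count; apply/allP => A /H; rewrite negbK.
by apply/hasP; rewrite has_count; exact: leq_ltn_trans lt.
Qed.

Definition dist u v := (\sum_(i < n) (u i - v i + (v i - u i)))%N.

Lemma dist_lt u v u' v' c :
  (forall i, u' i - v' i + (v' i - u' i) <= u i - v i + (v i - u i))%N ->
  (u' c - v' c + (v' c - u' c) < u c - v c + (v c - u c))%N ->
  (dist u' v' < dist u v)%N.
Proof.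
move=> le lt; rewrite /dist (bigD1 c) //= [X in (_ < X)%N](bigD1 c) //=.
by rewrite -addSn; apply: leq_add => //; apply: leq_sum.
Qed.

Lemma dist_sym u v : dist u v = dist v u.
Proof. by apply: eq_bigr => i _; rewrite addnC. Qed.

Lemma dist_exchange u u' v c y : (u + U_(c) = u' + U_(y))%MM ->
  (u c < v c)%N -> (v y < u y)%N -> (dist u' v < dist u v)%N.
Proof.
move=> /mnmP E uvc vuy.
have cy : c != y by apply: contraTneq uvc => ->; rewrite -leqNgt ltnW.
apply: (@dist_lt _ _ _ _ c) => [i|].
  have [ei|ci] := eqVneq c i; have [ei'|yi] := eqVneq y i;
  by move: (E i); rewrite !mnmDE !mnm1E ?ei ?ei' ?eqxx ?(negbTE ci) ?(negbTE yi);
     move: uvc vuy; rewrite ?ei ?ei'; clear; lia.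
by move: (E c); rewrite !mnmDE !mnm1E eqxx eq_sym (negbTE cy); clear -uvc; lia.
Qed.

(** Here y gains nothing and loses nothing, since both sides drop it; the
    progress is made at a and at c. *)
Lemma dist_exchange2 u u' v v' a c y :
  (u + U_(c) = u' + U_(y))%MM -> (v + U_(a) = v' + U_(y))%MM -> a != c ->
  (u c < v c)%N -> (v a < u a)%N -> (dist u' v' < dist u v)%N.
Proof.
move=> /mnmP E /mnmP E' ac uvc vua.
apply: (@dist_lt _ _ _ _ c) => [i|].
  move: (E i) (E' i); rewrite !mnmDE !mnm1E.
  have [ei|ci] := eqVneq c i.
    by rewrite -ei (negbTE ac); clear -uvc; case: (y == c); lia.
  have [ei|ai] := eqVneq a i; first by rewrite -ei; clear -vua; case: (y == a); lia.
  by clear; case: (y == i); lia.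
move: (E c) (E' c); rewrite !mnmDE !mnm1E eqxx (negbTE ac).
by clear -uvc; case: (y == c); lia.
Qed.

Lemma set2_eq A c x : c \in A -> x \in A -> x != c -> #|A| = 2%N -> A = [set c; x].
Proof.
move=> cA xA xc A2; apply/esym/eqP; rewrite eqEcard A2 cards2 eq_sym xc andbT.
by apply/fintype.subsetP => y; rewrite !inE => /orP[/eqP->|/eqP->].
Qed.

(** Suppose that no member of s turns into a member of t by an exchange raising
    an excess variable of t.  If B = {c, x} and some A in s contained x, then
    trading for c the other element of A would be such an exchange; so x occurs
    nowhere in s, and is in excess as well. *)
Lemma excess_in_pair s t c B : {in s & t, forall A B, #|A| = #|B|} ->
  {in s & t, forall A B, A <> B} ->
  {in s & t, forall A B c, c \in B :\: A -> (set_sum s c < set_sum t c)%N -> #|B :\: A| <> 1%N} ->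
  (set_sum s c < set_sum t c)%N -> B \in t -> c \in B -> #|B| = 2%N ->
  forall x, x \in B -> (set_sum s x < set_sum t x)%N.
Proof.
move=> card neq H clt Bt cB B2 x xB.
have [-> //|xc] := eqVneq x c.
have BE := set2_eq cB xB xc B2.
have -> : set_sum s x = 0%N.
  rewrite set_sumE; apply/eqP; rewrite -leqn0 leqNgt -has_count.
  apply/hasPn => A As; apply/negP => xA.
  have [cA|cA] := boolP (c \in A).
    apply: (neq A B As Bt); apply/esym/eqP; rewrite eqEcard (card _ _ As Bt) leqnn andbT.
    by rewrite BE; apply/fintype.subsetP => y; rewrite !inE => /orP[/eqP->|/eqP->].
  apply: (H A B As Bt c _ clt); first by rewrite !inE cA.
  suff -> : B :\: A = [set c] by rewrite cards1.
  apply/setP => y; rewrite BE !inE.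
  by have [->|yc] := eqVneq y c; rewrite ?cA //=; case: eqVneq => [->|]; rewrite ?xA ?andbF.
by rewrite set_sumE -has_count; apply/hasP; exists B.
Qed.

(** The counterpart for complements: if the complement of A is {c, x} and some B
    in t omitted x, then A and B would differ by an exchange raising c; so x
    occurs everywhere in t but not in A. *)
Lemma excess_off_copair s t c A : size s = size t -> {in s & t, forall A B, #|A| = #|B|} ->
  {in s & t, forall A B, A <> B} ->
  {in s & t, forall A B c, c \in B :\: A -> (set_sum s c < set_sum t c)%N -> #|B :\: A| <> 1%N} ->
  (set_sum s c < set_sum t c)%N -> A \in s -> c \notin A -> #|~: A| = 2%N ->
  forall x, x \notin A -> (set_sum s x < set_sum t x)%N.
Proof.
move=> st card neq H clt As cA A2 x xA.
have [-> //|xc] := eqVneq x c.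
have AE : ~: A = [set c; x] by apply: set2_eq => //; rewrite inE.
have -> : set_sum t x = size t.
  rewrite set_sumE; apply/eqP; rewrite -all_count.
  apply/allP => B Bt; apply: contrapT => /negP xB.
  have [cB|cB] := boolP (c \in B); last first.
    apply: (neq A B As Bt); apply/esym/eqP; rewrite eqEcard (card _ _ As Bt) leqnn andbT.
    rewrite -finset.setCS AE; apply/fintype.subsetP => y.
    by rewrite !inE => /orP[/eqP->|/eqP->].
  apply: (H A B As Bt c _ clt); first by rewrite !inE cA.
  suff -> : B :\: A = [set c] by rewrite cards1.
  apply/setP => y; rewrite finset.setDE AE !inE.
  by have [->|yc] := eqVneq y c; rewrite ?cB //=; case: eqVneq => [->|]; rewrite ?(negbTE xB) ?andbF.
rewrite -st set_sumE ltn_neqAle count_size andbT -all_count.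
by apply/negP => /allP /(_ _ As); rewrite (negbTE xA).
Qed.

(** In at most five variables, two d-sets with two elements in each difference
    have d = 2, or else d = 3 and n = 5, and then they cover all variables.  In
    the first case one takes sets made of excess variables, in the second case
    sets whose complements are; either way the two differences consist of
    excess variables.  The bound on the intersection is what n <= 5 gives. *)
Lemma excess_pair d k s t : (n <= 5)%N ->
  size s = k -> size t = k ->
  {in s, forall A, #|A| = d} -> {in t, forall A, #|A| = d} ->
  {in s & t, forall A B, A <> B} ->
  {in s & t, forall A B c, c \in B :\: A -> (set_sum s c < set_sum t c)%N -> #|B :\: A| <> 1%N} ->
  {in t & s, forall A B c, c \in B :\: A -> (set_sum t c < set_sum s c)%N -> #|B :\: A| <> 1%N} ->
  set_sum s <> set_sum t ->
  exists A B, [/\ A \in s, B \in t, #|B :\: A| = 2%N &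
    [/\ #|A :&: B| <= 1,
        (forall x, x \in A :\: B -> (set_sum t x < set_sum s x)%N) &
        (forall x, x \in B :\: A -> (set_sum s x < set_sum t x)%N)]]%N.
Proof.
move=> n5 sk tk sd td neq Hst Hts nst.
have st : size s = size t by rewrite sk.
have card_st : {in s & t, forall A B, #|A| = #|B|} by move=> A B /sd -> /td ->.
have card_ts : {in t & s, forall A B, #|A| = #|B|} by move=> A B /td -> /sd ->.
have neq' : {in t & s, forall A B, A <> B} by move=> A B At Bs /esym; exact: neq.
have dst : mdeg (set_sum s) = mdeg (set_sum t).
  by rewrite (mdeg_set_sum sd) (mdeg_set_sum td) st.
have [c clt] := deg_eq_excess dst nst.
have [b blt] := deg_eq_excess (esym dst) (nesym nst).
have cardsE A B : A \in s -> B \in t ->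
  [/\ (#|A :&: B| + #|B :\: A| = d)%N, #|A :\: B| = #|B :\: A| &
      (d + #|B :\: A| <= n)%N].
  move=> As Bt.
  have hA := cardsID B A; have hB := cardsID A B; rewrite (finset.setIC B A) in hB.
  rewrite (sd _ As) in hA; rewrite (td _ Bt) in hB; split=> //; first lia.
  have := max_card (mem (A :|: B)); rewrite card_ord cardsU (sd _ As) (td _ Bt).
  lia.
have two A B x : A \in s -> B \in t -> x \in B :\: A ->
    (set_sum s x < set_sum t x)%N -> #|B :\: A| = 2%N.
  move=> As Bt xBA xlt.
  have [h1 h2 h3] := cardsE _ _ As Bt; have h4 := Hst _ _ As Bt _ xBA xlt.
  have : (0 < #|B :\: A|)%N by apply/card_gt0P; exists x.
  lia.
suff [A [B [As Bt hA hB]]] : exists A B, [/\ A \in s, B \in t,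
    forall x, x \in A :\: B -> (set_sum t x < set_sum s x)%N &
    forall x, x \in B :\: A -> (set_sum s x < set_sum t x)%N].
  have [h1 h2 h3] := cardsE _ _ As Bt.
  have /set0Pn[x xBA] : B :\: A != finset.set0.
    apply/negP; rewrite finset.setD_eq0 => BA; apply: (neq _ _ As Bt).
    by apply/esym/eqP; rewrite eqEcard BA (card_st _ _ As Bt) leqnn.
  have h4 := two _ _ _ As Bt xBA (hB _ xBA).
  by exists A, B; split=> //; split=> //; lia.
have [[A0 A0s cA0] [B0 B0t cB0]] := excess_blocks st clt.
have [[B1 B1t bB1] [A1 A1s bA1]] := excess_blocks (esym st) blt.
have h2 : #|B0 :\: A0| = 2%N by apply: (two A0 B0 c) => //; rewrite inE cA0.
have [h0 h1 h3] := cardsE _ _ A0s B0t.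
have [d2|d3] : d = 2%N \/ d.+2 = n by lia.
  exists A1, B0; split=> // x; rewrite inE => /andP[_ xI].
    by apply: (excess_in_pair card_ts neq' Hts blt A1s bA1 _ xI); rewrite sd.
  by apply: (excess_in_pair card_st neq Hst clt B0t cB0 _ xI); rewrite td.
have cC A : #|A| = d -> #|~: A| = 2%N.
  by have := cardsC A; rewrite card_ord; lia.
exists A0, B1; split=> // x; rewrite inE => /andP[xI _].
  by apply: (excess_off_copair (esym st) card_ts neq' Hts blt B1t bB1 _ xI); exact/cC/td.
by apply: (excess_off_copair st card_st neq Hst clt A0s cA0 _ xI); exact/cC/sd.
Qed.

(** The first step of a path from A to B inside the union of A and B.  This is
    all that linear relations of the ideal itself have to provide. *)
Definition locally_linked F := forall A B, F A -> F B -> #|B :\: A| = 2%N ->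
  exists W, [/\ F W, W \subset A :|: B & #|W :\: A| = 1%N].

Lemma ksums_cons F k A m : F A -> ksums F k m -> ksums F k.+1 (mesym1 A + m)%MM.
Proof.
move=> FA [s [sk sF ->]]; exists (A :: s); split; rewrite /= ?sk ?set_sum_cons //.
by move=> B; rewrite inE => /predU1P[->|/sF].
Qed.

Lemma setD1_exchange A B : #|A| = #|B| -> #|B :\: A| = 1%N ->
  exists b c, A :\: B = [set b] /\ B :\: A = [set c].
Proof.
move=> AB BA; have AB' : #|A :\: B| = 1%N.
  have := cardsID B A; have := cardsID A B; rewrite (finset.setIC B A); lia.
by move/eqP/cards1P: AB' => [b ->]; move/eqP/cards1P: BA => [c ->]; exists b, c.
Qed.

(** Lexicographic induction on the number of factors and on the distance of the
    two sums.  A common factor is cancelled.  If an exchange inside u or v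
    creates a common factor and raises an excess variable, it is made.
    Otherwise [excess_pair] yields factors A of u and B of v, and the local
    condition a first step A -> W and a first step B -> Z.  Each raises an
    excess variable; if one of them lowers a variable outside of the
    intersection of A and B, this variable is in excess on the other side and
    the distance drops.  Otherwise both lower the single element of the
    intersection, and making both steps brings the sums closer. *)
Lemma ksums_linked d F : (n <= 5)%N -> (forall A, F A -> #|A| = d) ->
  locally_linked F ->
  forall k L u v, ksums F k u -> ksums F k v -> (u <= L)%MM -> (v <= L)%MM ->
  linked (ksums F k) L u v.
Proof.
move=> n5 Fd Floc; elim=> [|k IHk] L u v.
  case=> -[|? ?] [// _ sF ->] [[|? ?] [// _ tF ->]] uL vL.
  by apply: linked_refl => //; exists [::].
set G := ksums F k.+1.
have [N] := ubnP (dist u v); elim: N u v => // N IHN u v /ltnSE duv.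
case=> s [sk sF uE] [t [tk tF vE]] uL vL.
have card_F A B : F A -> F B -> #|A| = #|B| by move=> /Fd -> /Fd ->.
(* a common factor is cancelled from u, v and L *)
have common s' t' A : size s' = k.+1 -> size t' = k.+1 ->
    {in s', forall A, F A} -> {in t', forall A, F A} ->
    (set_sum s' <= L)%MM -> (set_sum t' <= L)%MM ->
    A \in s' -> A \in t' -> linked G L (set_sum s') (set_sum t').
  move=> s'k t'k s'F t'F; move=> + + As At.
  rewrite (set_sum_rem As) (set_sum_rem At) => sL tL.
  have AL : (mesym1 A <= L)%MM by apply: lepm_trans sL; exact: lem_addr.
  have ksr r : size r = k.+1 -> {in r, forall A, F A} -> A \in r ->
     ksums F k (set_sum (rem A r)).
    by move=> rk rF Ar; exists (rem A r); split; rewrite ?size_rem ?rk // => B /mem_rem/rF.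
  have leB m : (mesym1 A + m <= L)%MM -> (m <= L - mesym1 A)%MM.
    by move=> /mnm_lepP mL; apply/mnm_lepP => i; move: (mL i); rewrite mnmDE mnmBE; lia.
  rewrite -(submK AL) addmC; apply: (@linked_translate _ (ksums F k)).
    by move=> m; apply: ksums_cons; exact: s'F.
  by apply: IHk; [exact: ksr|exact: ksr|exact: leB|exact: leB].
have step r A B b c w : size r = k.+1 -> {in r, forall A, F A} -> A \in r -> F B ->
    A :\: B = [set b] -> B :\: A = [set c] -> (set_sum r <= L)%MM -> (w <= L)%MM ->
    (set_sum r c < w c)%N ->
    [/\ G (set_sum (B :: rem A r)), (set_sum (B :: rem A r) <= L)%MM,
       (set_sum r + U_(c) = set_sum (B :: rem A r) + U_(b))%MM &
       linked G L (set_sum r) (set_sum (B :: rem A r))].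
  move=> rk rF Ar FB AB BA rL wL lt.
  have E := exchange_sum Ar AB BA.
  have L' := exchange_le E rL wL lt.
  have G' : G (set_sum (B :: rem A r)).
    exists (B :: rem A r); split=> //; first by rewrite /= size_rem // rk.
    by move=> C; rewrite inE => /predU1P[->//|/mem_rem/rF].
  split=> //; apply: linked_step E _ => //; last exact: linked_refl.
  by exists r.
(* if A and B differ by an exchange raising an excess variable, then replacing
   A by B creates the common factor B *)
have swap s' t' : size s' = k.+1 -> size t' = k.+1 ->
    {in s', forall A, F A} -> {in t', forall A, F A} ->
    (set_sum s' <= L)%MM -> (set_sum t' <= L)%MM ->
    {in s' & t', forall A B c, c \in B :\: A ->
      (set_sum s' c < set_sum t' c)%N -> #|B :\: A| = 1%N ->
      linked G L (set_sum s') (set_sum t')}.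
  move=> s'k t'k s'F t'F sL tL A B As Bt c cBA lt /(setD1_exchange (card_F _ _ (s'F _ As) (t'F _ Bt))).
  case=> b [c' [AB BA]]; have cc' : c = c' by apply/set1P; rewrite -BA.
  rewrite -{c'}cc' in BA.
  have [[r [rk rF rE]] rL E lnk] := step _ _ _ _ _ _ s'k s'F As (t'F _ Bt) AB BA sL tL lt.
  apply: linked_trans lnk _; apply: (common _ _ B) => //; rewrite ?mem_head //.
    by rewrite /= size_rem // s'k.
  by move=> C; rewrite inE => /predU1P[->|/mem_rem/s'F //]; exact: t'F.
subst u v; apply: contrapT => NL.
have st : set_sum s <> set_sum t.
  by move=> E; apply: NL; rewrite -E; apply: linked_refl => //; exists s.
have [A [B [As Bt BA2 [AB1 hA hB]]]] : exists A B, [/\ A \in s, B \in t, #|B :\: A| = 2%N &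
    [/\ #|A :&: B| <= 1,
        (forall x, x \in A :\: B -> (set_sum t x < set_sum s x)%N) &
        (forall x, x \in B :\: A -> (set_sum s x < set_sum t x)%N)]]%N.
  apply: (@excess_pair d k.+1) => //.
  - by move=> A /sF/Fd.
  - by move=> A /tF/Fd.
  - by move=> A B As Bt E; apply: NL; apply: (common _ _ A) => //; rewrite E.
  - by move=> A B As Bt c cBA lt BA1; apply: NL; apply: (swap s t _ _ _ _ _ _ A B As Bt c).
  - move=> A B As Bt c cBA lt BA1; apply/NL/linked_sym.
    by apply: (swap t s _ _ _ _ _ _ A B As Bt c).
have FA := sF _ As; have FB := tF _ Bt.
have AB2 : #|A :\: B| = 2%N.
  have := cardsID B A; have := cardsID A B; rewrite (finset.setIC B A) (card_F _ _ FA FB); lia.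
have [W [FW WU WA1]] := Floc _ _ FA FB BA2.
have [Z [FZ ZU ZB1]] := Floc _ _ FB FA AB2.
have [y [c [AW WA]]] := setD1_exchange (card_F _ _ FA FW) WA1.
have [z [a [BZ ZB]]] := setD1_exchange (card_F _ _ FB FZ) ZB1.
have /andP[cA cW] : (c \notin A) && (c \in W) by rewrite -finset.in_setD WA set11.
have /andP[aB aZ] : (a \notin B) && (a \in Z) by rewrite -finset.in_setD ZB set11.
have /andP[yW yA] : (y \notin W) && (y \in A) by rewrite -finset.in_setD AW set11.
have /andP[zZ zB] : (z \notin Z) && (z \in B) by rewrite -finset.in_setD BZ set11.
have cB : c \in B.
  by move/fintype.subsetP/(_ _ cW): WU; rewrite inE (negbTE cA).
have aA : a \in A.
  by move/fintype.subsetP/(_ _ aZ): ZU; rewrite inE (negbTE aB).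
have clt : (set_sum s c < set_sum t c)%N by apply: hB; rewrite inE cA cB.
have alt : (set_sum t a < set_sum s a)%N by apply: hA; rewrite inE aB aA.
have [GsW sWL EW lW] := step _ _ _ _ _ _ sk sF As FW AW WA uL vL clt.
have [GtZ tZL EZ lZ] := step _ _ _ _ _ _ tk tF Bt FZ BZ ZB vL uL alt.
have Gs : G (set_sum s) by exists s.
have Gt : G (set_sum t) by exists t.
apply: NL.
have [yB|yB] := boolP (y \in B); last first.
  apply: linked_trans lW _; apply: IHN => //; apply: leq_trans duv.
  by apply: dist_exchange EW clt _; apply: hA; rewrite inE yB yA.
have [zA|zA] := boolP (z \in A); last first.
  apply: linked_trans (linked_sym lZ); apply: IHN => //; apply: leq_trans duv.
  rewrite dist_sym [X in (_ < X)%N]dist_sym.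
  by apply: dist_exchange EZ alt _; apply: hB; rewrite inE zB zA.
(* both steps lower an element of the intersection, which has at most one *)
have yz : y = z.
  by have /card_le1_eqP := AB1; apply; rewrite inE ?yA ?yB ?zA ?zB.
subst z; apply: linked_trans lW _; apply: linked_trans (linked_sym lZ).
apply: IHN => //; apply: leq_trans duv.
by apply: dist_exchange2 EW EZ _ clt alt; apply: contraNneq cA => <-.
Qed.

End SquarefreeSums.

(** * The index and Betti numbers as suprema *)

Section ExtendedIntegers.

(** A nonempty set of natural numbers has a supremum in the extended integers:
    its maximum, or infinity when it is unbounded. *)
Lemma le_supremum_nat (x0 : \bar int) (S : set nat) r : S r ->
  (r%:Z%:E <= supremum x0 [set b%:Z%:E | b in S])%E.
Proof.
move=> Sr; apply: ge_supremum_Nmem; last by exists r.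
have [[N SN]|unb] := pselect (exists N, forall s, S s -> (s <= N)%N).
  have ex : exists s, `[< S s >] by exists r; apply/asboolP.
  have bd s : `[< S s >] -> (s <= N)%N by move/asboolP/SN.
  case: (ex_maxnP ex bd) => m /asboolP Sm mmax.
  exists m%:Z%:E; split=> [_ [s Ss <-]|y]; last by apply; exists m.
  by rewrite lee_fin lez_nat; apply/mmax/asboolP.
exists +oo%E; split=> [_ [s _ <-]|[z| |] yub]; rewrite ?leey //.
- exfalso; apply: unb; exists `|z|%N => s Ss.
  have /yub : [set b%:Z%:E | b in S]%classic s%:Z%:E by exists s.
  by rewrite lee_fin; lia.
- have /yub : [set b%:Z%:E | b in S]%classic r%:Z%:E by exists r.
  by rewrite leeNy_eq.
Qed.

Variables (K : fieldType) (n : nat).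
Implicit Type I : set {mpoly K[n]}.

Lemma gl_index_gt1 I : (1 < gl_index I)%E <-> exists2 r, (1 <= r)%N & step_linear I r.
Proof.
rewrite /gl_index; split=> [|[r r1 Ir]]; last first.
  apply: (@lt_le_trans _ _ (1%:E + 1)%E); first by rewrite -EFinD lte_fin.
  apply: leeD2r; apply: le_trans (le_supremum_nat _ Ir).
  by rewrite lee_fin; lia.
move=> lt; apply: contrapT => H.
have S0 r : step_linear I r -> r = 0%N.
  by move=> Ir; apply/eqP; rewrite -leqn0 leqNgt; apply/negP => r1; apply: H; exists r.
move: lt; have [I0|nI0] := pselect (step_linear I 0).
  rewrite (_ : [set r%:Z%:E | r in _]%classic = [set 0%E]%classic).
    by rewrite supremum1 add0e ltxx.
  apply/seteqP; split=> [_ [r /S0 -> <-] //|_ ->]; by exists 0%N.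
rewrite (_ : [set r%:Z%:E | r in _]%classic = classical_sets.set0).
  by rewrite supremum0.
by apply/seteqP; split=> // _ [r /= Ir _]; apply: nI0; rewrite -(S0 r Ir).
Qed.

End ExtendedIntegers.

Section QuotDim.
Variables (K : fieldType) (V : lmodType K).
Implicit Types Z B : set V.

Lemma quot_dim_eq0 Z B : (forall z, Z z -> B z) -> quot_dim Z B = 0%E.
Proof.
move=> ZB; rewrite /quot_dim.
rewrite (_ : [set b%:Z%:E | b in _]%classic = [set 0%E]%classic) ?supremum1 //.
apply/seteqP; split=> [_ [[|b] [v [vZ vB]] <-] //|_ ->].
  exfalso; have /= := vB (fun l => (l == ord0)%:R) _ ord0 => F.
  suff /eqP : 1 = 0 :> K by rewrite oner_eq0.
  apply: F; rewrite (bigD1 ord0) //= scale1r big1 ?addr0; first exact/ZB/vZ.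
  by move=> i /negbTE ->; rewrite scale0r.
by exists 0%N => //; exists (fun=> 0); split=> [[]|a _ []].
Qed.

(** A single vector independent modulo B would already force dimension 1. *)
Lemma quot_dim0_mem Z B z : quot_dim Z B = 0%E -> Z z -> exists2 a : K, a != 0 & B (a *: z).
Proof.
move=> Z0 Zz; apply: contrapT => H.
suff : (1%:Z%:E <= quot_dim Z B)%E by rewrite Z0.
apply: le_supremum_nat; exists (fun=> z); split=> // a; rewrite big_ord1 => Ba l.
by rewrite ord1; apply/eqP/negPn/negP => a0; apply: H; exists (a ord0).
Qed.

End QuotDim.

(** * Monomial ideals through their supports *)

Section MonomialIdeals.
Variables (K : fieldType) (n : nat).
Implicit Types (I : set {mpoly K[n]}) (G : 'X_{1..n} -> Prop) (p q : {mpoly K[n]}).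

Definition multiple G (m : 'X_{1..n}) := exists2 g, G g & (g <= m)%MM.

(** Membership in a monomial ideal is decided monomial by monomial; all facts on
    ideals used below are read off from this property. *)
Definition spanned_by I G :=
  forall p, I p <-> forall m, m \in msupp p -> multiple G m.

Lemma ideal_genD (X : set {mpoly K[n]}) p q :
  ideal_gen X p -> ideal_gen X q -> ideal_gen X (p + q).
Proof.
move=> [s [a [g [Xg ->]]]] [s' [a' [g' [Xg' ->]]]].
exists (s + s')%N, (fun i => match fintype.split i with inl j => a j | inr j => a' j end),
  (fun i => match fintype.split i with inl j => g j | inr j => g' j end).
split=> [i|]; first by case: fintype.split.
rewrite big_split_ord /=; congr (_ + _); apply: eq_bigr => i _.
  by rewrite (unsplitK (inl i)).
by rewrite (unsplitK (inr i)).
Qed.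

Lemma mem_ideal_gen (X : set {mpoly K[n]}) a g : X g -> ideal_gen X (a * g).
Proof. by move=> Xg; exists 1%N, (fun=> a), (fun=> g); rewrite big_ord1. Qed.

Lemma ideal_gen_msupp (X : set {mpoly K[n]}) p :
  (forall m, m \in msupp p -> exists m0, (m0 <= m)%MM /\ X 'X_[m0]) -> ideal_gen X p.
Proof.
move=> H; rewrite [p]mpolyE big_seq.
apply: (big_ind (ideal_gen X)) => [|q q' |m /H[m0 [m0m Xm0]]].
- by exists 0%N, (fun=> 0), (fun=> 0); split; [case|rewrite big_ord0].
- exact: ideal_genD.
- by rewrite -(submK m0m) mpolyXD scalerAl; apply: mem_ideal_gen.
Qed.

Lemma msupp_ideal_gen (X : set {mpoly K[n]}) p m : ideal_gen X p -> m \in msupp p ->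
  exists g m0, [/\ X g, m0 \in msupp g & (m0 <= m)%MM].
Proof.
move=> [s [a [g [Xg ->]]]] /msupp_sum_le/flattenP[_ /mapP[i _ ->]].
move=> /msuppM_le/allpairsP[[m1 m2] /= [_ m2g ->]].
by exists (g i), m2; split=> //; exact: lem_addl.
Qed.

Lemma spanned_byX I G m : spanned_by I G -> I 'X_[m] <-> multiple G m.
Proof.
move=> IG; split=> [/IG|Gm]; first by apply; rewrite msuppX mem_seq1.
by apply/IG => m'; rewrite msuppX mem_seq1 => /eqP ->.
Qed.

Lemma ideal_gen_spanned (G : set 'X_{1..n}) :
  spanned_by (ideal_gen [set 'X_[K, m] | m in G]%classic) G.
Proof.
move=> p; split=> [pI m mp|H].
  have [_ [m0 [[m1 Gm1 <-] + m0m]]] := msupp_ideal_gen pI mp.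
  by rewrite msuppX mem_seq1 => /eqP m01; exists m1 => //; rewrite -m01.
apply: ideal_gen_msupp => m /H[g Gg gm].
by exists g; split=> //; exists g.
Qed.

Lemma spanned_monomial I G : spanned_by I G -> monomial_ideal I.
Proof.
move=> IG; exists G; apply/seteqP.
by split=> p; rewrite ideal_gen_spanned IG.
Qed.

Lemma spanned_generated I G D : spanned_by I G -> (forall m, G m -> mdeg m = D) ->
  generated_in_degree I D.
Proof.
move=> IG GD; apply/seteqP; split=> p.
  move=> /IG H; apply: ideal_gen_msupp => m /H[g Gg gm]; exists g; split=> //; split.
    by apply/(spanned_byX _ IG); exists g; rewrite ?lepm_refl.
  by apply/dhomogP => m'; rewrite msuppX mem_seq1 => /eqP -> /=; exact: GD.
move=> pI; apply/IG => m mp.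
have [g [m0 [[/IG Ig _] m0g m0m]]] := msupp_ideal_gen pI mp.
by have [h Gh hm0] := Ig _ m0g; exists h => //; apply: lepm_trans m0m.
Qed.

(** Taking every squarefree monomial of degree d in I, and not a chosen
    generating set, makes the family depend on I and d only. *)
Definition generating_sets I d (A : {set 'I_n}) := #|A| = d /\ I 'X_[mesym1 A].

(** Every monomial of I has a divisor of degree d in I, which in turn is a
    multiple of a squarefree element of M; elements of I have degree at least
    d, so that the two coincide. *)
Lemma squarefree_spanned I d : squarefree_monomial_ideal I -> generated_in_degree I d ->
  spanned_by I (ksums (generating_sets I d) 1).
Proof.
move=> [M [Msf IE]] Id; have IM : spanned_by I M by rewrite IE; exact: ideal_gen_spanned.
have low m : multiple M m -> exists m0, [/\ (m0 <= m)%MM, mdeg m0 = d & multiple M m0].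
  move=> /(spanned_byX _ IM); rewrite {1}Id => Im.
  have [|g [m0 [[Ig gd] m0g m0m]]] := msupp_ideal_gen Im (m := m).
    by rewrite msuppX mem_seq1.
  exists m0; split=> //; last by move/IM: Ig; apply.
  by move/dhomogP: gd; apply.
have deg_le (m0 m : 'X_{1..n}) : (m0 <= m)%MM -> mdeg m = (mdeg (m - m0) + mdeg m0)%N.
  by move=> le; rewrite -mdegD submK.
move=> p; rewrite IM; split=> H m /H.
  move=> /low[m0 [m0m m0d [m1 Mm1 m10]]].
  have [m2 [m21 m2d _]] : exists m2, [/\ (m2 <= m1)%MM, mdeg m2 = d & multiple M m2].
    by apply: low; exists m1; rewrite ?lepm_refl.
  have m1d : mdeg m1 = d by move: (deg_le _ _ m21) (deg_le _ _ m10); lia.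
  have m1E : m1 = mesym1 [set i | m1 i != 0%N].
    by apply/mnmP => i; rewrite mnmE inE; move: (Msf _ Mm1 i); case: (m1 i) => [|[|]].
  exists m1; last exact: lepm_trans m0m.
  exists [:: [set i | m1 i != 0%N]]; split=> //; last by rewrite /set_sum big_seq1.
  move=> A; rewrite inE => /eqP ->; split; first by rewrite -mdeg_mesym1 -m1E.
  by rewrite -m1E; apply/(spanned_byX _ IM); exists m1; rewrite ?lepm_refl.
move=> [_ [[|A [|? ?]] [// _ sF ->] le]].
have [_ /(spanned_byX _ IM)[m1 Mm1 m1A]] := sF A (mem_head _ _).
exists m1 => //; apply: lepm_trans le.
by rewrite /set_sum big_seq1.
Qed.

Lemma ideal_pow_spanned I F : spanned_by I (ksums F 1) ->
  forall k, spanned_by (ideal_pow I k) (ksums F k).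
Proof.
move=> IF; elim=> [|k IHk] p.
  split=> // _ m _; exists 0%MM; last by apply/mnm_lepP => i; rewrite mnm0E.
  by exists [::]; split=> //; rewrite /set_sum big_nil.
split=> [pI m mp|H].
  have [_ [m0 [[f [g [fI gI ->]]] m0p m0m]]] := msupp_ideal_gen pI mp.
  have /allpairsP[[m1 m2] /= [m1f m2g m0E]] := msuppM_le m0p.
  have [_ [[|A [|? ?]] [// _ AF ->]] Am1] := (IF f).1 fI _ m1f.
  have [w Gw wm2] := (IHk g).1 gI _ m2g.
  exists (mesym1 A + w)%MM; first by apply: ksums_cons => //; apply: AF; rewrite mem_head.
  apply: lepm_trans m0m; rewrite m0E; move: Am1; rewrite /set_sum big_seq1.
  move=> /mnm_lepP Am1; move/mnm_lepP: wm2 => wm2.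
  by apply/mnm_lepP => i; rewrite !mnmDE leq_add.
apply: ideal_gen_msupp => m /H[_ [[|A s] [// [sk] sF ->] le]].
exists (set_sum (A :: s)); split=> //.
exists 'X_[mesym1 A], 'X_[set_sum s]; split; last by rewrite set_sum_cons mpolyXD.
  apply/(spanned_byX _ IF); exists (mesym1 A); last exact: lepm_refl.
  exists [:: A]; split; rewrite ?/set_sum ?big_seq1 // => B.
  by rewrite inE => /eqP ->; apply: sF; rewrite mem_head.
apply/(spanned_byX _ IHk); exists (set_sum s); last exact: lepm_refl.
by exists s; split=> // B Bs; apply: sF; rewrite inE Bs orbT.
Qed.

End MonomialIdeals.

(** * The low degrees of the Koszul complex of a monomial ideal *)

Section KoszulHomology.
Variables (K : fieldType) (n : nat).
Notation chain := {ffun {set 'I_n} -> {mpoly K[n]}}.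
Implicit Types (I : set {mpoly K[n]}) (G : 'X_{1..n} -> Prop) (c : chain).
Implicit Types (A : {set 'I_n}) (m : 'X_{1..n}) (p q : 'I_n).

(** The Koszul basis vector x^m e_A. *)
Definition mono A m : chain := [ffun B => if B == A then 'X_[m] else 0].

Lemma koszul_diffD c c' : koszul_diff (c + c') = koszul_diff c + koszul_diff c'.
Proof.
apply/ffunP => B; rewrite !ffunE -big_split /=; apply: eq_bigr => i _.
by rewrite ffunE mulrDr.
Qed.

Lemma koszul_diffZ (a : K) c : koszul_diff (a *: c) = a *: koszul_diff c.
Proof.
apply/ffunP => B; rewrite !ffunE scaler_sumr; apply: eq_bigr => i _.
by rewrite ffunE scalerAr.
Qed.

Lemma koszul_diff0 : koszul_diff (0 : chain) = 0.
Proof. by rewrite -[0 in LHS](scale0r 0) koszul_diffZ scale0r. Qed.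

Lemma koszul_diff_sum (T : Type) (r : seq T) (f : T -> chain) :
  koszul_diff (\sum_(x <- r) f x) = \sum_(x <- r) koszul_diff (f x).
Proof. exact: (big_morph _ koszul_diffD koszul_diff0). Qed.

Lemma chain_mono c : c = \sum_A \sum_(m <- msupp (c A)) (c A)@_m *: mono A m.
Proof.
apply/ffunP => B; rewrite sum_ffunE (bigD1 B) //= [X in _ + X]big1 ?addr0.
  rewrite sum_ffunE {1}[c B]mpolyE; apply: eq_bigr => m _.
  by rewrite !ffunE eqxx.
move=> A AB; rewrite sum_ffunE big1 // => m _.
by rewrite !ffunE eq_sym (negbTE AB) scaler0.
Qed.

Lemma koszul_diff_mono A m : koszul_diff (mono A m) =
  \sum_(i in A) (-1 : K) ^+ #|[pred b in A :\ i | (b < i)%N]| *: mono (A :\ i) (m + U_(i))%MM.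
Proof.
apply/ffunP => B; rewrite ffunE sum_ffunE /= big_mkcond [RHS]big_mkcond /=.
apply: eq_bigr => i _; rewrite !ffunE.
have [iB|iB] := boolP (i \in B) => /=.
  case: ifP => // iA; case: eqVneq => [BE|_]; last by rewrite scaler0.
  by rewrite BE !inE eqxx in iB.
have [<-|BA] := eqVneq (i |: B)%SET A.
  rewrite setU11 finset.setU1K // eqxx -mulrA -mpolyXD addmC.
  rewrite -[RHS]mul_mpolyC rmorphXn /= rmorphN rmorph1 //.
rewrite mulr0; case: ifP => // iA; case: eqVneq => [BE|_]; last by rewrite scaler0.
by rewrite BE finset.setD1K ?eqxx in BA.
Qed.

Lemma koszul_diff_mono1 p m : koszul_diff (mono [set p] m) = mono finset.set0 (m + U_(p))%MM.
Proof.
rewrite koszul_diff_mono big_set1 finset.setDv eq_card0 ?scale1r // => b.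
by rewrite !inE.
Qed.

Lemma koszul_diff_mono2 p q m : p != q -> koszul_diff (mono [set p; q] m) =
  (-1 : K) ^+ (q < p)%N *: (mono [set q] (m + U_(p))%MM - mono [set p] (m + U_(q))%MM).
Proof.
move=> pq; rewrite koszul_diff_mono big_setU1 ?inE //= big_set1.
have -> : [set p; q] :\ p = [set q] by rewrite finset.setU1K // inE.
have -> : [set p; q] :\ q = [set p] by rewrite finset.setUC finset.setU1K // inE eq_sym.
have sgn (x y : 'I_n) : #|[pred b in [set x] | (b < y)%N]| = (x < y)%N.
  have [xy|xy] := ltnP x y.
    by rewrite -[RHS](card1 x); apply: eq_card => b; rewrite !inE; case: eqVneq => [->|].
  by apply: eq_card0 => b; rewrite !inE; case: eqVneq => // ->; rewrite ltnNge xy.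
rewrite !sgn scalerBr; congr (_ + _).
move: pq; rewrite neq_ltn; case: (ltngtP p q) => //= _ _; rewrite ?expr1 ?scaleN1r ?scale1r //.
by rewrite opprK.
Qed.

(** In multidegree a, write [p] for the vector (x^a / x_p) e_p, for the variables
    p such that x^a / x_p lies in I.  The boundaries are spanned by the [p] - [q]
    with x^a / (x_p x_q) in I, and the cycles are the combinations with
    coefficients of sum zero: the homology vanishes as soon as this graph is
    connected. *)
Section Boundaries.
Variables (I : set {mpoly K[n]}) (G : 'X_{1..n} -> Prop).
Hypothesis IG : spanned_by I G.

Definition boundary i j c := exists2 b, koszul_chains I i j b & koszul_diff b = c.

Lemma koszul_chains_lin i j (a : K) c c' : koszul_chains I i j c -> koszul_chains I i j c' ->
  koszul_chains I i j (a *: c + c').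
Proof.
move=> [ci cI] [c'i c'I]; split=> [A Ai|A]; first by rewrite !ffunE ci // c'i // scaler0 addr0.
have [cA cAj] := cI A; have [cA' cAj'] := c'I A.
rewrite !ffunE; split; last by move=> m /msuppD_le; rewrite mem_cat => /orP[/msuppZ_le/cAj|/cAj'].
by apply/IG => m /msuppD_le; rewrite mem_cat => /orP[/msuppZ_le|]; apply: (IG _).1.
Qed.

Lemma koszul_chains0 i j : koszul_chains I i j 0.
Proof.
split=> [A _|A]; rewrite ffunE //; split=> [|m]; last by rewrite msupp0.
by apply/IG => m; rewrite msupp0.
Qed.

Lemma koszul_chains_mono A m j : multiple G m -> (mdeg m + #|A|)%N = j ->
  koszul_chains I #|A| j (mono A m).
Proof.
move=> Gm mj; split=> [B BA|B]; rewrite ffunE; case: eqVneq => [E|_] //.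
- by rewrite E in BA.
- split; first exact/(spanned_byX _ IG).
  by move=> m'; rewrite msuppX mem_seq1 => /eqP ->; rewrite E.
- split=> [|m']; last by rewrite msupp0.
  by apply/IG => m'; rewrite msupp0.
Qed.

Lemma boundary_lin i j (a : K) c c' : boundary i j c -> boundary i j c' ->
  boundary i j (a *: c + c').
Proof.
move=> [b bI <-] [b' bI' <-]; exists (a *: b + b'); first exact: koszul_chains_lin.
by rewrite koszul_diffD koszul_diffZ.
Qed.

Lemma boundary0 i j : boundary i j 0.
Proof. by exists 0; [exact: koszul_chains0|exact: koszul_diff0]. Qed.

Lemma boundaryD i j c c' : boundary i j c -> boundary i j c' -> boundary i j (c + c').
Proof. by move=> bc bc'; rewrite -[c]scale1r; exact: boundary_lin. Qed.

Lemma boundaryZ i j (a : K) c : boundary i j c -> boundary i j (a *: c).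
Proof. by move=> bc; rewrite -[_ *: _]addr0; apply: boundary_lin => //; exact: boundary0. Qed.

Lemma boundary_sum i j (T : eqType) (r : seq T) (f : T -> chain) :
  (forall x, x \in r -> boundary i j (f x)) -> boundary i j (\sum_(x <- r) f x).
Proof.
move=> H; rewrite big_seq; apply: big_ind => // [|c c']; first exact: boundary0.
exact: boundaryD.
Qed.

Lemma boundary_edge p q m j : multiple G m -> (mdeg m).+2 = j ->
  boundary 2%N j (mono [set q] (m + U_(p))%MM - mono [set p] (m + U_(q))%MM).
Proof.
move=> Gm mj; have [->|pq] := eqVneq p q; first by rewrite subrr; exact: boundary0.
have -> : mono [set q] (m + U_(p))%MM - mono [set p] (m + U_(q))%MM =
   (-1 : K) ^+ (q < p)%N *: koszul_diff (mono [set p; q] m).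
  by rewrite koszul_diff_mono2 // scalerA -exprD addnn -mul2n exprM sqrrN expr1n expr1n scale1r.
apply: boundaryZ; exists (mono [set p; q] m) => //.
have c2 : #|[set p; q]| = 2%N by rewrite cards2 pq.
by rewrite -c2; apply: koszul_chains_mono => //; rewrite c2 addn2.
Qed.

Variable D : nat.
Hypothesis GD : forall m, G m -> mdeg m = D.

Lemma mdeg_lt_excess (m m' : 'X_{1..n}) : (mdeg m < mdeg m')%N -> exists s, (m s < m' s)%N.
Proof.
move=> lt; apply: contrapT => H; suff le : (m' <= m)%MM.
  by move: lt; rewrite -(submK le) mdegD; lia.
by apply/mnm_lepP => i; rewrite leqNgt; apply/negP => hi; apply: H; exists i.
Qed.

Lemma betti0_eq0 j : (D < j)%N -> betti I 0 j = 0%E.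
Proof.
move=> Dj; apply: quot_dim_eq0 => c [[c0 cI] _].
change (boundary 1 j c); rewrite [c]chain_mono.
apply: boundary_sum => A _; apply: boundary_sum => m mc; apply: boundaryZ.
have [A0|] := pselect (#|A| = 0%N); last first.
  by move=> /c0 cA; rewrite cA msupp0 in mc.
have [/IG/(_ _ mc)[g Gg gm] /(_ _ mc)] := cI A; rewrite A0 addn0 => mj.
have [s gs] : exists s, (g s < m s)%N by apply: mdeg_lt_excess; rewrite mj GD.
have sm : (U_(s) <= m)%MM by rewrite lep1mP -lt0n; exact: leq_ltn_trans gs.
exists (mono [set s] (m - U_(s))%MM); last first.
  by move/cards0_eq: A0 => ->; rewrite koszul_diff_mono1 submK.
rewrite -{1}(cards1 s); apply: koszul_chains_mono; last first.
  by rewrite cards1 -mj -{2}(submK sm) mdegD mdeg1.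
exists g => //; move/mnm_lepP: gm => gm; apply/mnm_lepP => i.
by move: (gm i); rewrite mnmBE mnm1E; case: eqVneq gs => [<-|_]; lia.
Qed.

(** If one generator g divides x^a / x_p and x^a / x_q for distinct p and q, it
    divides x^a / (x_p x_q): the variables coming from g form a clique. *)
Lemma boundary_common_generator (a g : 'X_{1..n}) p q : G g -> (g <= a)%MM ->
  (g p < a p)%N -> (g q < a q)%N ->
  boundary 2%N (mdeg a) (mono [set p] (a - U_(p))%MM - mono [set q] (a - U_(q))%MM).
Proof.
move=> Gg /mnm_lepP ga gp gq; have [->|pq] := eqVneq p q.
  by rewrite subrr; exact: boundary0.
pose m := (a - U_(p) - U_(q))%MM.
have ple : (U_(p) <= a)%MM by rewrite lep1mP -lt0n; exact: leq_ltn_trans gp.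
have qle : (U_(q) <= a)%MM by rewrite lep1mP -lt0n; exact: leq_ltn_trans gq.
have qle' : (U_(q) <= a - U_(p))%MM.
  by rewrite lep1mP mnmBE mnm1E (negbTE pq) subn0 -lt0n; exact: leq_ltn_trans gq.
have ple' : (U_(p) <= a - U_(q))%MM.
  by rewrite lep1mP mnmBE mnm1E [q == p]eq_sym (negbTE pq) subn0 -lt0n; exact: leq_ltn_trans gp.
have mp : (a - U_(p) = m + U_(q))%MM by rewrite submK.
have mq : (a - U_(q) = m + U_(p))%MM by rewrite /m submDA [(U_(p) + _)%MM]addmC -submDA submK.
rewrite mp mq; apply: boundary_edge; last first.
  by rewrite -[in RHS](submK ple) mp !mdegD !mdeg1; lia.
exists g => //; apply/mnm_lepP => i; rewrite /m !mnmBE !mnm1E.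
move: (ga i) gp gq; have [<-|_] := eqVneq p i.
  by rewrite [q == p]eq_sym (negbTE pq); clear; lia.
by clear; case: (q =P i) => [<-|_]; lia.
Qed.

(** Consecutive generators of a path share a variable of the graph: the lcm of
    two generators differing by an exchange has degree at most D + 1, less than
    that of x^a, so some variable is left over for both.  The cliques of the
    generators along the path are therefore connected. *)
Lemma boundary_linked (a u v : 'X_{1..n}) p q : (D.+1 < mdeg a)%N -> linked G a u v ->
  (u p < a p)%N -> (v q < a q)%N ->
  boundary 2%N (mdeg a) (mono [set p] (a - U_(p))%MM - mono [set q] (a - U_(q))%MM).
Proof.
move=> Da luv; elim: luv p => [{}u Gu ua p up uq|{}u {}v w b c Gu ua E lvw IH p up wq].
  exact: boundary_common_generator ua up uq.
have [Gv va] := linked_src lvw.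
have [s us] : exists s, ((u + U_(c))%MM s < a s)%N.
  by apply: mdeg_lt_excess; rewrite mdegD mdeg1 GD // addn1.
have vs : (v s < a s)%N by move: us; rewrite E mnmDE; lia.
have {}us : (u s < a s)%N by move: us; rewrite mnmDE; lia.
rewrite -[mono [set p] _](subrK (mono [set s] (a - U_(s))%MM)) -addrA.
by apply: boundaryD; [exact: boundary_common_generator up us|exact: IH].
Qed.

Hypothesis Glinked : forall L u v, G u -> G v -> (u <= L)%MM -> (v <= L)%MM -> linked G L u v.

Lemma betti1_eq0 j : (D.+1 < j)%N -> betti I 1 j = 0%E.
Proof.
move=> Dj; apply: quot_dim_eq0 => c [[c1 cI] dc0].
change (boundary 2%N j c).
(* T a is [q] for a chosen vertex q in multidegree a.  Replacing every
   (x^a / x_p) e_p of c by T a changes c by a boundary.  The result c' is the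
   image of the Koszul differential of c under the linear map x^a |-> T a, so
   that it vanishes with this differential; this avoids splitting c into its
   multigraded components. *)
pose root (a : 'X_{1..n}) := [pick q | (a q != 0%N) && `[< multiple G (a - U_(q))%MM >]].
pose T (a : 'X_{1..n}) := if root a is Some q then mono [set q] (a - U_(q))%MM else 0.
pose Phi (f : {mpoly K[n]}) := \sum_(a : 'X_{1..n < j.+1}) f@_a *: T a.
have PhiD f g : Phi (f + g) = Phi f + Phi g.
  by rewrite -big_split; apply: eq_bigr => a _; rewrite mcoeffD scalerDl.
have Phi0 : Phi 0 = 0 by apply: big1 => a _; rewrite mcoeff0 scale0r.
have PhiZ a f : Phi (a *: f) = a *: Phi f.
  by rewrite scaler_sumr; apply: eq_bigr => b _; rewrite mcoeffZ scalerA.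
have PhiX a : (mdeg a < j.+1)%N -> Phi 'X_[a] = T a.
  move=> aj; rewrite /Phi (bigD1 (BMultinom aj)) //= mcoeffX eqxx scale1r.
  rewrite big1 ?addr0 // => b ba; rewrite mcoeffX eq_sym.
  suff /negbTE -> : (b : 'X_{1..n}) != a by rewrite scale0r.
  by apply: contra ba => /eqP ba; apply/eqP/val_inj.
pose c' p := \sum_(m <- msupp (c [set p])) (c [set p])@_m *: T (m + U_(p))%MM.
have degc p m : m \in msupp (c [set p]) -> mdeg (m + U_(p))%MM = j.
  by move=> /(cI _).2; rewrite cards1 mdegD mdeg1.
have c'0 : \sum_p c' p = 0.
  rewrite -[RHS]Phi0; move/ffunP/(_ finset.set0): dc0; rewrite !ffunE => <-.
  rewrite (big_morph Phi PhiD Phi0) [RHS]big_mkcond; apply: eq_bigr => p _.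
  rewrite inE /= finset.setU0 [X in _ ^+ X]eq_card0 ?mul1r; last by move=> b; rewrite !inE.
  rewrite {1}[c [set p]]mpolyE mulr_sumr (big_morph Phi PhiD Phi0) /c' !big_seq.
  apply: eq_bigr => m mc; rewrite -scalerAr -mpolyXD PhiZ [(U_(p) + m)%MM]addmC PhiX //.
  by rewrite (degc p).
have -> : c = \sum_p ((\sum_(m <- msupp (c [set p])) (c [set p])@_m *: mono [set p] m) - c' p).
  rewrite sumrB c'0 subr0 {1}[c]chain_mono.
  apply/ffunP => B; rewrite !sum_ffunE.
  have [B1|B1] := pselect (#|B| = 1%N); last first.
    rewrite !big1 // => [p|A] _; rewrite sum_ffunE big_seq big1 // => m mc; rewrite !ffunE.
      by case: eqVneq => [E|_]; rewrite ?scaler0 //; rewrite E cards1 in B1.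
    by case: eqVneq => [E|_]; rewrite ?scaler0 //; rewrite -E c1 ?msupp0 in mc.
  move/eqP/cards1P: B1 => [p ->].
  rewrite (bigD1 [set p]) //= [RHS](bigD1 p) //= [X in _ + X]big1 ?addr0.
    rewrite [X in _ + X]big1 ?addr0 // => q qp; rewrite sum_ffunE big1 // => m _.
    by rewrite !ffunE (inj_eq set1_inj) eq_sym (negbTE qp) scaler0.
  move=> A Ap; rewrite sum_ffunE big1 // => m _.
  by rewrite !ffunE eq_sym (negbTE Ap) scaler0.
apply: boundary_sum => p _; rewrite -sumrB; apply: boundary_sum => m mc.
rewrite -scalerBr; apply: boundaryZ; rewrite -(degc _ _ mc).
have [/IG/(_ _ mc)[g Gg gm] _] := cI [set p].
set a := (m + U_(p))%MM; have -> : m = (a - U_(p))%MM by rewrite addmK.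
have strict h x : (U_(x) <= a)%MM -> (h <= a - U_(x))%MM -> (h <= a)%MM /\ (h x < a x)%N.
  rewrite lep1mP => ax /mnm_lepP hx; split; last first.
    by move: (hx x); rewrite mnmBE mnm1E eqxx; lia.
  by apply/mnm_lepP => i; move: (hx i); rewrite mnmBE; lia.
have [ga gp] : (g <= a)%MM /\ (g p < a p)%N.
  by apply: strict; rewrite ?addmK // lem_addl.
rewrite /T /root; case: pickP => [q /andP[aq /asboolP[h Gh ha]]|/(_ p)]; last first.
  rewrite /a addmK mnmDE mnm1E eqxx addn1 /= => /asboolP[].
  by exists g.
have [ha' hq] : (h <= a)%MM /\ (h q < a q)%N by apply: strict; rewrite ?lep1mP.
apply: (boundary_linked _ _ gp hq); first by rewrite (degc _ _ mc).
exact: Glinked.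
Qed.

End Boundaries.

Lemma step_linear1 I G D : spanned_by I G -> (exists m, G m) -> (forall m, G m -> mdeg m = D) ->
  (forall L u v, G u -> G v -> (u <= L)%MM -> (v <= L)%MM -> linked G L u v) ->
  step_linear I 1.
Proof.
move=> IG [g Gg] GD Gl; split; first exact: spanned_monomial IG.
  exists 'X_[g]; last by rewrite -msupp_eq0 msuppX.
  by apply/(spanned_byX _ IG); exists g; rewrite ?lepm_refl.
exists D; split; first exact: spanned_generated IG GD.
move=> [|[|//]] j _ Dj; first by apply: (betti0_eq0 IG GD); rewrite addn0 in Dj.
by apply: (betti1_eq0 IG GD Gl); rewrite addn1 in Dj.
Qed.

(** Let S = B \ A and let a be the squarefree monomial of the union of A and B.
    Without a first step from A to B, no edge of the graph in multidegree a
    joins S to its complement.  Both contain a vertex, an x of S because of A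
    and a y of A \ B because of B; the sum over S of the coefficients kills all
    boundaries but not the cycle [x] - [y]. *)
Lemma betti1_locally_linked I F d : (forall A, F A -> #|A| = d) ->
  spanned_by I (ksums F 1) -> betti I 1 d.+2 = 0%E -> locally_linked F.
Proof.
move=> Fd IF b1 A B FA FB BA2; apply: contrapT => H.
have FX m : multiple (ksums F 1) m <-> exists2 C, F C & (mesym1 C <= m)%MM.
  split=> [[_ [[|C [|? ?]] [// _ CF ->]]]|[C FC Cm]].
    by rewrite /set_sum big_seq1 => Cm; exists C => //; apply: CF; rewrite mem_head.
  exists (mesym1 C) => //; exists [:: C]; split; rewrite ?/set_sum ?big_seq1 // => C'.
  by rewrite inE => /eqP ->.
set S := B :\: A; set a := mesym1 (A :|: B).
have ad : mdeg a = d.+2.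
  have := cardsID A B; rewrite -/S BA2 mdeg_mesym1 cardsU (Fd _ FA) (Fd _ FB) finset.setIC.
  by lia.
have [x xS] : exists x, x \in S by apply/card_gt0P; rewrite BA2.
have [y yA yB] : exists2 y, y \in A & y \notin B.
  have : (0 < #|A :\: B|)%N.
    have := cardsID B A; have := cardsID A B; rewrite (finset.setIC B A) (Fd _ FA) (Fd _ FB) -/S BA2.
    lia.
  by case/card_gt0P => y; rewrite inE => /andP[yB yA]; exists y.
have xA : x \notin A by move: xS; rewrite inE => /andP[].
have xB : x \in B by move: xS; rewrite inE => /andP[].
have lea p : p \in A :|: B -> (U_(p) <= a)%MM by move=> pU; rewrite lep1mP mnmE pU.
have xa : (U_(x) <= a)%MM by apply: lea; rewrite inE xB orbT.
have ya : (U_(y) <= a)%MM by apply: lea; rewrite inE yA.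
have ch p C : F C -> C \subset (A :|: B) :\ p -> (U_(p) <= a)%MM ->
    koszul_chains I 1 d.+2 (mono [set p] (a - U_(p))%MM).
  move=> FC /fintype.subsetP CU pa; rewrite -{1}(cards1 p); apply: (koszul_chains_mono IF).
    apply/FX; exists C => //; apply/mnm_lepP => i; rewrite mnmBE mnm1E !mnmE.
    move: (CU i); rewrite !inE; case: (i \in C) => // /(_ isT) /andP[ip ->].
    by rewrite eq_sym (negbTE ip).
  by rewrite cards1 -ad -{2}(submK pa) mdegD mdeg1.
pose z := (-1 : K) *: mono [set y] (a - U_(y))%MM + mono [set x] (a - U_(x))%MM.
have zch : koszul_chains I 1 d.+2 z.
  apply: (koszul_chains_lin IF); [apply: (ch y B) => //|apply: (ch x A) => //].
    by rewrite finset.subsetD1 yB finset.subsetUr.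
  by rewrite finset.subsetD1 xA finset.subsetUl.
have dz : koszul_diff z = 0.
  by rewrite koszul_diffD koszul_diffZ !koszul_diff_mono1 !submK // scaleN1r addNr.
have [l l0 [b [b2 bI] bz]] := quot_dim0_mem b1 (conj zch dz).
pose phi (c : chain) := \sum_(p in S) (c [set p])@_(a - U_(p))%MM.
have phiD c c' : phi (c + c') = phi c + phi c'.
  by rewrite -big_split; apply: eq_bigr => p _; rewrite ffunE mcoeffD.
have phi0 : phi 0 = 0 by apply: big1 => p _; rewrite ffunE mcoeff0.
have phiZ k c : phi (k *: c) = k * phi c.
  by rewrite mulr_sumr; apply: eq_bigr => p _; rewrite ffunE mcoeffZ.
have phi_mono p m : phi (mono [set p] m) = ((p \in S) && (m == a - U_(p))%MM)%:R.
  have [pS|pS] /= := boolP (p \in S); last first.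
    rewrite /phi big1 // => q qS; rewrite ffunE; case: eqVneq => [/set1_inj E|_].
      by rewrite E (negbTE pS) in qS.
    by rewrite mcoeff0.
  rewrite /phi (bigD1 p) //= ffunE eqxx mcoeffX big1 ?addr0 // => q /andP[_ qp].
  by rewrite ffunE (inj_eq set1_inj) (negbTE qp) mcoeff0.
have : phi (l *: z) = l.
  have yS : y \notin S by rewrite inE yA.
  by rewrite phiZ phiD phiZ !phi_mono xS !eqxx (negbTE yS) /= mulr0 add0r mulr1.
rewrite -bz; move: l0 => /[swap] <- /eqP; apply.
rewrite [b]chain_mono koszul_diff_sum (big_morph phi phiD phi0) big1 // => C _.
rewrite koszul_diff_sum (big_morph phi phiD phi0) big_seq big1 // => m mb.
rewrite koszul_diffZ phiZ.
have [/eqP/cards2P[p [q [pq CE]]]|C2] := pselect (#|C| = 2%N); last first.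
  by rewrite b2 ?msupp0 in mb.
have [bI' bd] := bI C.
have md : (mdeg m).+2 = d.+2 by have := bd _ mb; rewrite CE cards2 pq addn2.
have /FX[W FW Wm] := (IF _).1 bI' _ mb.
have mW : m = mesym1 W.
  rewrite -{1}(submK Wm); suff /eqP -> : (m - mesym1 W)%MM == 0%MM by rewrite add0m.
  have := mdegD (m - mesym1 W) (mesym1 W).
  by rewrite submK // mdeg_mesym1 (Fd _ FW) -mdeg_eq0; case: md => ->; clear; lia.
rewrite CE koszul_diff_mono2 // phiZ phiD -scaleN1r phiZ !phi_mono mulN1r.
(* an edge of the graph from q' in S to p' outside of S comes from a set W in F,
   the union of A and B without p' and q', and W is a first step from A to B *)
have key p' q' : p' != q' -> (m + U_(p') = a - U_(q'))%MM -> q' \in S -> p' \in S.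
  move=> pq' /mnmP E q'S; apply: contrapT => /negP p'S; apply: H; exists W; split=> //.
    apply/fintype.subsetP => i iW; apply: contrapT => /negP iU.
    by move: (E i); rewrite mW mnmDE mnmBE !mnm1E !mnmE iW (negbTE iU); clear; lia.
  suff -> : W :\: A = S :\ q'.
    by have := cardsD1 q' S; rewrite q'S BA2 => -[].
  apply/setP => i; move: (E i) q'S p'S; rewrite mW mnmDE mnmBE !mnm1E !mnmE !inE.
  rewrite [i == q']eq_sym; have [<-|ip] := eqVneq p' i.
    rewrite [q' == p']eq_sym (negbTE pq').
    by case: (p' \in A); case: (p' \in B); case: (p' \in W).
  have [<-|iq] := eqVneq q' i; first by case: (q' \in A); case: (q' \in B); case: (q' \in W).
  by case: (i \in A); case: (i \in B); case: (i \in W).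
have swapE p' q' : q' \in A :|: B -> (m + U_(p') = a - U_(q'))%MM ->
    (m + U_(q') = a - U_(p'))%MM.
  move=> q'U E; have /mnmP {}E : (m + U_(p') + U_(q') = a)%MM by rewrite E submK // lea.
  by apply/mnmP => i; move: (E i); rewrite !(mnmDE, mnmBE); clear; lia.
have SU q' : q' \in S -> q' \in A :|: B by rewrite !inE => /andP[_ ->]; rewrite orbT.
suff -> : (q \in S) && (m + U_(p) == a - U_(q))%MM = (p \in S) && (m + U_(q) == a - U_(p))%MM.
  by rewrite subrr !mulr0.
have qp : q != p by rewrite eq_sym.
apply/andP/andP => -[hS /eqP hE]; split.
- exact: key hE hS.
- exact/eqP/swapE/hE/SU.
- exact: key hE hS.
- exact/eqP/swapE/hE/SU.
Qed.

End KoszulHomology.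

(** * Powers of squarefree ideals *)

Theorem theorem2p5 (K : fieldType) (n : nat) (hn : (n <= 5)%N)
    (I : set {mpoly K[n]}) (hI : squarefree_monomial_ideal I)
    (hidx : (1 < gl_index I)%E) (k : nat) (hk : (1 <= k)%N) :
  (1 < gl_index (ideal_pow I k))%E.
Proof.
have [r r1 [_ [f If f0] [d [Id betti0]]]] := (gl_index_gt1 I).1 hidx.
have IF := squarefree_spanned hI Id.
set F := generating_sets I d in IF.
have Fd A : F A -> #|A| = d by case.
have Floc : locally_linked F.
  by apply: (betti1_locally_linked Fd IF); apply: betti0; rewrite ?addn1.
apply/gl_index_gt1; exists 1%N => //.
apply: (step_linear1 (ideal_pow_spanned IF k)); last first.
- by move=> L u v; exact: (ksums_linked hn Fd Floc).
- by move=> m; exact: (ksums_deg Fd).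
have [_ [[|A [|? ?]] [// _ AF _]] _] := (IF f).1 If _ (mlead_supp f0).
exists (set_sum (nseq k A)), (nseq k A); split; rewrite ?size_nseq // => B.
by rewrite mem_nseq => /andP[_ /eqP ->]; apply: AF; rewrite mem_head.
Qed.
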